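(* Let $n\in\mathbb{N}$, let $\theta\in\mathbb{R}^n$ be a vector with $\theta_i>0$ for all $i$, and let $\Omega\in\mathbb{R}^{n\times n}$ be the constant-correlation matrix $\Omega=(1-\rho)I+\rho\,\mathbf{1}\mathbf{1}^{\mathsf T}$ (ones on the diagonal, all off-diagonal entries equal to $\rho$), where $-\frac{1}{n-1}<\rho<1$. Then the solution to $$\min_{y\in\mathbb{R}^n}\ \tfrac12\, y^{\mathsf T}\Omega y-\theta^{\mathsf T}y\quad\text{s.t. } y\ge 0$$ is $$y=\frac{1}{1-\rho}\left(\theta-\bar\theta\,\mathbf{1}\right)^+,$$ where the threshold $\bar\theta\in\mathbb{R}$ is the solution to the fixed-point problem $$\bar\theta=\frac{\rho}{1-\rho}\,\mathbf{1}^{\mathsf T}\left(\theta-\bar\theta\,\mathbf{1}\right)^+.$$ Furthermore, if $\theta_n\le\cdots\le\theta_1$, then the solution to this fixed-point problem is $$\bar\theta=\frac{\rho}{1+(i-1)\rho}\sum_{j=1}^i\theta_j,$$ where $i\in\{1,\dots,n\}$ is the largest index such that $$\rho\le\frac{\theta_i}{\theta_i+\sum_{j=1}^{i-1}(\theta_j-\theta_i)}.$$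
   Context: $\mathbf{1}\in\mathbb{R}^n$ is the vector of all ones and $I$ the $n\times n$ identity. For a vector $v$, $v^+$ denotes the componentwise positive part, $(v^+)_j=\max(v_j,0)$. Vector inequalities are componentwise. In the paper $\theta_i=1/\sigma_i$ with $\sigma_i>0$ the volatility (standard deviation) of asset $i$, so $\theta_n\le\cdots\le\theta_1$ is equivalent to $\sigma_1\le\cdots\le\sigma_n$. For $n=1$, the quantity $-\frac{1}{n-1}$ is read as $-\infty$. *)

(* Defs.v *)
From mathcomp Require Import all_boot all_order all_algebra.
From mathcomp Require Import reals.

Set Implicit Arguments.
Unset Strict Implicit.
Unset Printing Implicit Defensive.

Import Order.TTheory GRing.Theory Num.Theory.
Local Open Scope ring_scope.

Definition ones (R : realType) (n : nat) : 'cV[R]_n := const_mx 1.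

Definition pos_part (R : realType) (n : nat) (v : 'cV[R]_n) : 'cV[R]_n :=
  map_mx (fun x : R => Num.max x 0) v.

Definition const_corr (R : realType) (n : nat) (rho : R) : 'M[R]_n :=
  (1 - rho) *: 1%:M + rho *: (ones R n *m (ones R n)^T).

Definition qp_objective (R : realType) (n : nat) (Omega : 'M[R]_n)
    (theta y : 'cV[R]_n) : R :=
  2^-1 * (y^T *m Omega *m y) 0 0 - (theta^T *m y) 0 0.

Definition nonneg_vec (R : realType) (n : nat) (y : 'cV[R]_n) : Prop :=
  forall i : 'I_n, 0 <= y i 0.

Definition is_minimizer (R : realType) (T : Type) (f : T -> R)
    (feasible : T -> Prop) (y : T) : Prop :=
  feasible y /\ (forall z : T, feasible z -> f y <= f z).

Definition is_fixed_threshold (R : realType) (n : nat) (rho : R)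
    (theta : 'cV[R]_n) (t : R) : Prop :=
  t = rho / (1 - rho) * ((ones R n)^T *m pos_part (theta - t *: ones R n)) 0 0.

(* Indices are zero-based: [k : 'I_n] stands for the index i = k + 1 of
   {1, ..., n}, so i - 1 is [k], the sum over j = 1, ..., i - 1 is the sum over
   [j < k], and the sum over j = 1, ..., i is the sum over [j <= k]. *)
Definition threshold_cond (R : realType) (n : nat) (rho : R)
    (theta : 'cV[R]_n) (k : 'I_n) : Prop :=
  rho <= theta k 0 /
         (theta k 0 + \sum_(j < n | (j < k)%N) (theta j 0 - theta k 0)).

Definition is_largest_index (n : nat) (P : 'I_n -> Prop) (k : 'I_n) : Prop :=
  P k /\ (forall l : 'I_n, P l -> (l <= k)%N).

Definition threshold_formula (R : realType) (n : nat) (rho : R)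
    (theta : 'cV[R]_n) (k : 'I_n) : R :=
  rho / (1 + k%:R * rho) * \sum_(j < n | (j <= k)%N) theta j 0.

(* Main.v *)
Require Import Defs.
From mathcomp Require Import all_boot all_order all_algebra.
From mathcomp Require Import reals.
From mathcomp Require Import ring lra.

(** Write [t = rho * u].  The positive part is the largest of the partial sums
    [\sum_(j in A) (theta j - t)] over index sets [A], so [t] is a fixed point
    exactly when [u] is the maximum over [A] of
    [(\sum_(j in A) theta j) / (1 + (#|A| - 1) rho)]; all these denominators are
    positive.  This gives existence and uniqueness for either sign of [rho].
    For the fixed point, [Omega y - theta = (t - theta)^+] is nonnegative and
    complementary to [y], so [y] satisfies the KKT conditions of a strictly
    convex program.  For decreasing [theta], the index condition at [l] says
    [rho u <= theta l] for the [u] attached to [{j < l}], and equivalently for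
    the one attached to [{j <= l}]; hence at the largest such index [k] the set
    [{j <= k}] is the active set. *)

Set Implicit Arguments.
Unset Strict Implicit.
Unset Printing Implicit Defensive.

Import Order.TTheory GRing.Theory Num.Theory.
Local Open Scope ring_scope.

(** * Positive denominators and sums of positive parts *)

Lemma corr_denom_gt0 (R : realFieldType) (n m : nat) (rho : R) :
  (0 < n)%N -> ((1 < n)%N -> - (1 / (n%:R - 1)) < rho) -> rho < 1 ->
  (m <= n)%N -> 0 < 1 - rho + m%:R * rho.
Proof.
move=> n_gt0 rho_lb rho_lt1 le_mn.
have m_ge0 : 0 <= m%:R :> R by rewrite ler0n.
(* For [rho < 0] the expression decreases in [m], so [m = n] is the worst case: there
   [1 + (n - 1) rho > 0] is the lower bound on [rho], or just [1 > 0] when [n = 1]. *)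
have [rho_ge0|rho_lt0] := leP 0 rho; first by nra.
suff : 0 < 1 - rho + n%:R * rho.
  by have : m%:R <= n%:R :> R; [rewrite ler_nat|nra].
have [n_gt1|n_le1] := ltnP 1 n; last first.
  by have -> : n = 1%N by [apply/eqP; rewrite eqn_leq n_le1]; lra.
have n1_gt0 : 0 < n%:R - 1 :> R by rewrite subr_gt0 ltr1n.
have := rho_lb n_gt1.
by rewrite -mulNr ltr_pdivrMr //; lra.
Qed.

Lemma pos_part_sum_ge (R : realDomainType) (I : finType) (v : I -> R)
    (A : {set I}) :
  \sum_(i in A) v i <= \sum_i Num.max (v i) 0.
Proof.
rewrite [leRHS](bigID (fun i => i \in A)) /=.
rewrite -[leLHS]addr0; apply: lerD.
  by apply: ler_sum => i _; rewrite le_max lexx.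
by apply: sumr_ge0 => i _; rewrite le_max lexx orbT.
Qed.

Lemma pos_part_sumE (R : realDomainType) (I : finType) (v : I -> R) :
  \sum_i Num.max (v i) 0 = \sum_(i in [set i | 0 <= v i]) v i.
Proof.
rewrite (bigID (fun i => 0 <= v i)) /= [X in _ + X]big1 => [|i]; last first.
  by rewrite -ltNge => /ltW/max_idPr.
rewrite addr0; apply: eq_big => [i|i /max_idPl //].
by rewrite inE.
Qed.

Lemma const_sum_sub (R : pzRingType) (I : finType) (v : I -> R) (A : {set I})
    (t : R) :
  \sum_(i in A) (v i - t) = \sum_(i in A) v i - #|A|%:R * t.
Proof. by rewrite sumrB sumr_const mulr_natl. Qed.

(** * The threshold as a maximum over index sets *)

Section ScaledThreshold.
Variables (R : realFieldType) (I : finType) (rho : R) (v : I -> R).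
Hypothesis denom_gt0 : forall A : {set I}, 0 < 1 - rho + #|A|%:R * rho.

Let u (A : {set I}) := (\sum_(i in A) v i) / (1 - rho + #|A|%:R * rho).

(** The fixed-point equation for [t = rho * w] with the factor [rho] cancelled, so that [rho = 0]
    and [rho < 0] need no separate treatment. *)
Definition scaled_threshold (w : R) : Prop :=
  (1 - rho) * w = \sum_i Num.max (v i - rho * w) 0.

(** Clearing the positive denominator and moving [#|A|%:R * rho * w] across turns the ratio into a
    partial sum of the shifted values. *)
Lemma subset_ratio_le (A : {set I}) (w : R) :
  (u A <= w) = (\sum_(i in A) (v i - rho * w) <= (1 - rho) * w).
Proof.
rewrite /u ler_pdivrMr ?denom_gt0 // const_sum_sub lerBlDr.
by congr (_ <= _); ring.
Qed.

Lemma subset_ratio_ge (A : {set I}) (w : R) :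
  (w <= u A) = ((1 - rho) * w <= \sum_(i in A) (v i - rho * w)).
Proof.
rewrite /u ler_pdivlMr ?denom_gt0 // const_sum_sub lerBrDr.
by congr (_ <= _); ring.
Qed.

Lemma scaled_thresholdP (w : R) :
  scaled_threshold w <-> (forall A, u A <= w) /\ (exists A, w <= u A).
Proof.
split=> [fix_w|[ub_w [A le_w]]].
  split=> [A|]; first by rewrite subset_ratio_le fix_w pos_part_sum_ge.
  by exists [set i | 0 <= v i - rho * w];
     rewrite subset_ratio_ge fix_w pos_part_sumE.
apply/le_anti/andP; split.
  rewrite subset_ratio_ge in le_w.
  exact: le_trans le_w (pos_part_sum_ge _ _).
by rewrite pos_part_sumE -subset_ratio_le.
Qed.

Lemma scaled_threshold_exists : exists w, scaled_threshold w.
Proof.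
case: (@arg_maxP _ R {set I} set0 predT u isT) => A _ max_A.
by exists (u A); apply/scaled_thresholdP; split=> [B|]; [exact: max_A|exists A].
Qed.

Lemma scaled_threshold_unique (w1 w2 : R) :
  scaled_threshold w1 -> scaled_threshold w2 -> w1 = w2.
Proof.
move=> /scaled_thresholdP[ub1 [A1 le1]] /scaled_thresholdP[ub2 [A2 le2]].
by apply/le_anti; rewrite (le_trans le1) // (le_trans le2).
Qed.

End ScaledThreshold.

Lemma fixed_thresholdE (R : realType) (n : nat) (rho : R) (theta : 'cV[R]_n)
    (t : R) :
  is_fixed_threshold rho theta t <->
  t = rho / (1 - rho) * \sum_i Num.max (theta i 0 - t) 0.
Proof.
rewrite /is_fixed_threshold; have -> // :
  ((ones R n)^T *m pos_part (theta - t *: ones R n)) 0 0 =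
  \sum_i Num.max (theta i 0 - t) 0.
by rewrite !mxE; apply: eq_bigr => i _; rewrite !mxE mul1r mulr1.
Qed.

Lemma fixed_threshold_scaled (R : realType) (n : nat) (rho : R)
    (theta : 'cV[R]_n) (t : R) :
  rho < 1 ->
  is_fixed_threshold rho theta t <->
  exists2 w, scaled_threshold rho (fun i => theta i 0) w & t = rho * w.
Proof.
move=> rho_lt1; have rho1_neq0 : 1 - rho != 0 by rewrite gt_eqF // subr_gt0.
rewrite fixed_thresholdE; split=> [fix_t|[w fix_w ->]].
  (* The witness is the positive-part sum over [1 - rho] rather than [t / rho], which would fail at
     [rho = 0]. *)
  have def_t : t =
    rho * ((1 - rho)^-1 * \sum_i Num.max (theta i 0 - t) 0).
    by rewrite mulrA.
  exists ((1 - rho)^-1 * \sum_i Num.max (theta i 0 - t) 0) => //.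
  by rewrite /scaled_threshold -def_t mulVKf.
by rewrite -fix_w; field.
Qed.

(** * Optimality in the quadratic program *)

Lemma qp_objectiveE (R : realType) (n : nat) (rho : R) (theta y : 'cV[R]_n) :
  qp_objective (const_corr n rho) theta y =
  2^-1 * ((1 - rho) * (\sum_i y i 0 ^+ 2) + rho * (\sum_i y i 0) ^+ 2)
  - \sum_i theta i 0 * y i 0.
Proof.
rewrite /qp_objective /const_corr; congr (_ * _ - _); last first.
  by rewrite mxE; apply: eq_bigr => i _; rewrite mxE.
have onesy : (ones R n)^T *m y = (\sum_i y i 0)%:M.
  apply/matrixP => i j; rewrite !ord1 !mxE eqxx mulr1n.
  by apply: eq_bigr => k _; rewrite !mxE mul1r.
have yones : y^T *m ones R n = (\sum_i y i 0)%:M.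
  by rewrite -[LHS]trmxK trmx_mul trmxK onesy tr_scalar_mx.
rewrite mulmxDr mulmxDl -!scalemxAr -!scalemxAl mulmx1 mulmxA yones.
rewrite -mulmxA onesy -scalar_mxM !mxE eqxx mulr1n -expr2.
by congr (_ * _ + _); apply: eq_bigr => i _; rewrite mxE expr2.
Qed.

(** Cauchy-Schwarz against the all-ones vector: the gap is [n] times the sum of squared deviations
    from the mean. *)
Lemma sqr_sum_le (R : realFieldType) (n : nat) (d : 'I_n -> R) :
  (\sum_i d i) ^+ 2 <= n%:R * \sum_i d i ^+ 2.
Proof.
have [n0|n_gt0] := posnP n.
  by subst n; rewrite !big_ord0 mulr0 expr0n.
have n_gt0R : 0 < n%:R :> R by rewrite ltr0n.
have /(mulr_ge0 (ltW n_gt0R)) :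
    0 <= \sum_i (d i - n%:R^-1 * \sum_j d j) ^+ 2.
  by apply: sumr_ge0 => i _; exact: sqr_ge0.
set S := \sum_j d j.
have -> : \sum_i (d i - n%:R^-1 * S) ^+ 2 =
  \sum_i d i ^+ 2 - n%:R^-1 * S ^+ 2.
  under eq_bigr => i _ do rewrite sqrrB -mulrnAl.
  rewrite big_split /= sumrB sumr_const card_ord -mulr_suml sumrMnl.
  by rewrite -[in LHS]/S -mulr_natl -[S *+ 2]mulr_natl; field; rewrite gt_eqF.
by rewrite mulrBr mulVKf ?gt_eqF // subr_ge0.
Qed.

(** Positive definiteness of [const_corr]. With [S] the sum and [Q] the sum of squares, [n] times
    the form is [(1 - rho) (n Q - S^2) + (1 - rho + n rho) S^2]; both terms are nonnegative, so [S],
    and then [Q], vanishes. *)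
Lemma corr_form_def (R : realFieldType) (n : nat) (rho : R) (d : 'I_n -> R) :
  (0 < n)%N -> rho < 1 -> 0 < 1 - rho + n%:R * rho ->
  (1 - rho) * (\sum_i d i ^+ 2) + rho * (\sum_i d i) ^+ 2 <= 0 ->
  forall i, d i = 0.
Proof.
move=> n_gt0 rho_lt1 denom_gt0 form_le0.
have n_gt0R : 0 < n%:R :> R by rewrite ltr0n.
have CS := sqr_sum_le d.
set S := \sum_i d i in form_le0 CS; set Q := \sum_i d i ^+ 2 in form_le0 CS.
have Q_ge0 : 0 <= Q by apply: sumr_ge0 => i _; exact: sqr_ge0.
have S2_ge0 : 0 <= S ^+ 2 by exact: sqr_ge0.
have S2_0 : S ^+ 2 = 0 by apply/le_anti; rewrite S2_ge0 andbT; nra.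
have /eqP : Q = 0 by apply/le_anti; rewrite Q_ge0 andbT; nra.
rewrite psumr_eq0 => [/allP Q0 i|i _]; last exact: sqr_ge0.
by apply/eqP; rewrite -sqrf_eq0; apply: Q0; rewrite mem_index_enum.
Qed.

(** Expanding the objective about [y] leaves half the form at [z - y] plus the gradient at [y]
    paired with [z - y]; the KKT conditions make the pairing nonnegative. *)
Lemma corr_qp_gap (R : realType) (n : nat) (rho t : R)
    (theta y z : 'cV[R]_n) :
  rho < 1 -> is_fixed_threshold rho theta t ->
  y = (1 / (1 - rho)) *: pos_part (theta - t *: ones R n) ->
  nonneg_vec z ->
  2^-1 * ((1 - rho) * (\sum_i (z i 0 - y i 0) ^+ 2)
          + rho * (\sum_i (z i 0 - y i 0)) ^+ 2)
  <= qp_objective (const_corr n rho) theta z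
     - qp_objective (const_corr n rho) theta y.
Proof.
move=> rho_lt1 /fixed_thresholdE fix_t def_y z_ge0.
have rho1_neq0 : 1 - rho != 0 by rewrite gt_eqF // subr_gt0.
have yE i : (1 - rho) * y i 0 = Num.max (theta i 0 - t) 0.
  by rewrite def_y !mxE mulr1 mul1r mulVKf.
(* The fixed-point equation enters here: it makes the gradient at [y] equal to
   [(1 - rho) y + t - theta] componentwise. *)
have rho_sum_y : rho * (\sum_i y i 0) = t.
  rewrite [RHS]fix_t -(eq_bigr _ (fun i _ => yE i)) -mulr_sumr.
  by field.
(* Termwise: either [y i 0 = 0], and both factors are nonnegative, or the gradient component
   vanishes. *)
have slack : 0 <= \sum_i ((1 - rho) * y i 0 + t - theta i 0) * (z i 0 - y i 0).
  apply: sumr_ge0 => i _; have := yE i; have := z_ge0 i.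
  have [le_t|lt_t] := leP (theta i 0 - t) 0 => zi_ge0 yi.
    have -> : y i 0 = 0 by apply/eqP; rewrite -(mulrI_eq0 _ (mulfI rho1_neq0)) yi.
    by rewrite mulr0 subr0; apply: mulr_ge0; lra.
  by rewrite yi (_ : _ - t + t - _ = 0) ?mul0r //; ring.
rewrite !qp_objectiveE.
(* The two sides differ by exactly the slack sum, so an identity remains. *)
rewrite -subr_ge0; apply: (le_trans slack); rewrite le_eqVlt; apply/predU1P; left.
have -> : \sum_i ((1 - rho) * y i 0 + t - theta i 0) * (z i 0 - y i 0) =
  (1 - rho) * (\sum_i y i 0 * z i 0) - (1 - rho) * (\sum_i y i 0 ^+ 2)
  + t * (\sum_i z i 0) - t * (\sum_i y i 0)
  - \sum_i theta i 0 * z i 0 + \sum_i theta i 0 * y i 0.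
  rewrite !mulr_sumr -!sumrB -?big_split -?sumrB -?big_split /=.
  by rewrite -?sumrB -?big_split /=; apply: eq_bigr => i _; ring.
have -> : \sum_i (z i 0 - y i 0) ^+ 2 =
  \sum_i z i 0 ^+ 2 - 2 * (\sum_i y i 0 * z i 0) + \sum_i y i 0 ^+ 2.
  by rewrite mulr_sumr -sumrB -big_split; apply: eq_bigr => i _ /=; ring.
by rewrite sumrB -rho_sum_y; field.
Qed.

(** At a minimizer the gap bound forces the form at [y - y0] to be at most 0, hence [y = y0] by
    definiteness; conversely the form is nonnegative, so [y0] is optimal. *)
Lemma corr_qp_minimizer (R : realType) (n : nat) (rho t : R)
    (theta y : 'cV[R]_n) :
  (0 < n)%N -> rho < 1 -> 0 < 1 - rho + n%:R * rho ->
  is_fixed_threshold rho theta t ->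
  is_minimizer (qp_objective (const_corr n rho) theta) (@nonneg_vec R n) y <->
  y = (1 / (1 - rho)) *: pos_part (theta - t *: ones R n).
Proof.
move=> n_gt0 rho_lt1 denom_gt0 fix_t.
set y0 := (1 / (1 - rho)) *: _.
have y0_ge0 : nonneg_vec y0.
  move=> i; rewrite !mxE mulr_ge0 ?le_max ?lexx ?orbT //.
  by rewrite divr_ge0 // subr_ge0 ltW.
have gap := fun z => @corr_qp_gap R n rho t theta y0 z rho_lt1 fix_t erefl.
have gap_ge0 (d : 'I_n -> R) :
    0 <= (1 - rho) * (\sum_i d i ^+ 2) + rho * (\sum_i d i) ^+ 2.
  rewrite leNgt; apply/negP => form_lt0.
  have d0 := corr_form_def n_gt0 rho_lt1 denom_gt0 (ltW form_lt0).
  by move: form_lt0; rewrite !big1 ?expr0n ?mulr0 ?addr0 ?ltxx // => i _;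
     rewrite d0 ?expr0n.
split=> [[y_ge0 y_min]|->].
  have form_le0 := gap y y_ge0; have le_y := y_min y0 y0_ge0.
  apply/matrixP => i j; rewrite ord1; apply/eqP; rewrite -subr_eq0; apply/eqP.
  apply: (@corr_form_def _ _ rho (fun i => y i 0 - y0 i 0)) => //.
  by move: form_le0 le_y; rewrite -subr_ge0; lra.
split=> // z z_ge0; have := gap z z_ge0; have := gap_ge0 (fun i => z i 0 - y0 i 0).
by lra.
Qed.

(** * The active set for decreasing [theta] *)

Lemma threshold_condE (R : realType) (n : nat) (rho : R) (theta : 'cV[R]_n)
    (k : 'I_n) :
  (forall i, 0 < theta i 0) ->
  (forall i j : 'I_n, (i <= j)%N -> theta j 0 <= theta i 0) ->
  threshold_cond rho theta k <->
  rho * (\sum_(j < n | (j < k)%N) theta j 0)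
    <= (1 - rho + k%:R * rho) * theta k 0.
Proof.
move=> theta_gt0 theta_sorted; rewrite /threshold_cond.
have sum_ge0 : 0 <= \sum_(j < n | (j < k)%N) (theta j 0 - theta k 0).
  by apply: sumr_ge0 => j /ltnW lt_jk; rewrite subr_ge0 theta_sorted.
rewrite ler_pdivlMr ?ltr_wpDr //.
have -> : \sum_(j < n | (j < k)%N) (theta j 0 - theta k 0) =
  \sum_(j < n | (j < k)%N) theta j 0 - k%:R * theta k 0.
  rewrite sumrB sumr_const mulr_natl; congr (_ - _ *+ _).
  by rewrite -sum1_card (big_ord_narrow (ltnW (ltn_ord k))) sum1_card card_ord.
by split; lra.
Qed.

Lemma largest_index_active (R : realType) (n : nat) (rho : R)
    (theta : 'cV[R]_n) (k : 'I_n) :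
  (forall i, 0 < theta i 0) ->
  (forall i j : 'I_n, (i <= j)%N -> theta j 0 <= theta i 0) ->
  (forall m, (m <= n)%N -> 0 < 1 - rho + m%:R * rho) ->
  is_largest_index (threshold_cond rho theta) k ->
  scaled_threshold rho (fun i => theta i 0)
    ((\sum_(j < n | (j <= k)%N) theta j 0) / (1 + k%:R * rho)).
Proof.
move=> theta_gt0 theta_sorted denom_gt0 [cond_k max_k].
set w := _ / _.
have denomE : 1 + k%:R * rho = 1 - rho + k.+1%:R * rho.
  by rewrite -natr1; ring.
have kdenom_gt0 : 0 < 1 + k%:R * rho by rewrite denomE denom_gt0.
have sumE : \sum_(j < n | (j <= k)%N) theta j 0 = w * (1 + k%:R * rho).
  by rewrite divfK // gt_eqF.
have le_active (j : 'I_n) : (j <= k)%N -> rho * w <= theta j 0.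
  (* By monotonicity [j = k] suffices; splitting [theta k 0] off the sum then gives the index
     condition at [k]. *)
  move=> le_jk; apply: le_trans (theta_sorted _ _ le_jk).
  rewrite mulrA ler_pdivrMr // (bigD1 k) //=.
  move/threshold_condE: cond_k => /(_ theta_gt0 theta_sorted).
  rewrite [in X in X -> _](eq_bigl (fun j : 'I_n => (j <= k)%N && (j != k))).
    by lra.
  by move=> i; rewrite ltn_neqAle andbC.
have ge_inactive (j : 'I_n) : (k < j)%N -> theta j 0 <= rho * w.
  (* Only the successor [l] of [k] matters. The sum over [j < l] is the one defining [w], so
     [rho * w < theta l 0] would give the condition at [l], against maximality of [k]. *)
  move=> lt_kj; have lt_k1n : (k.+1 < n)%N by exact: leq_ltn_trans (ltn_ord j).
  pose l := Ordinal lt_k1n.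
  apply: (@le_trans _ _ (theta l 0)); first exact: theta_sorted.
  rewrite leNgt; apply/negP => lt_l.
  suff /max_k : threshold_cond rho theta l by rewrite ltnn.
  apply/threshold_condE => //=.
  rewrite (eq_bigl (fun j : 'I_n => (j <= k)%N)) => [|i]; last by rewrite ltnS.
  rewrite sumE -denomE mulrA mulrC; apply: ler_wpM2l; exact: ltW.
rewrite /scaled_threshold (bigID (fun j : 'I_n => (j <= k)%N)) /=.
rewrite [X in _ = _ + X]big1 => [|j]; last first.
  by rewrite -ltnNge => /ge_inactive ?; apply/max_idPr; rewrite subr_le0.
rewrite (eq_bigr (fun j => theta j 0 - rho * w)) => [|j /le_active ?]; last first.
  by apply/max_idPl; rewrite subr_ge0.
(* The active terms add up to [w (1 + k rho) - (k + 1) rho w = (1 - rho) w]. *)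
rewrite addr0 sumrB sumE sumr_const.
have -> : #|[pred j : 'I_n | (j <= k)%N]| = k.+1.
  by rewrite -sum1_card (big_ord_narrow (ltn_ord k)) sum1_card card_ord.
by rewrite -[rho * w *+ _]mulr_natl -natr1; ring.
Qed.

Lemma largest_index_exists (n : nat) (P : pred 'I_n) :
  (exists k, P k) -> exists k, is_largest_index P k.
Proof.
case=> k0 Pk0; case: (@arg_maxnP _ k0 P val Pk0) => k Pk max_k.
by exists k; split.
Qed.

Theorem proposition1 (R : realType) (n : nat) (theta : 'cV[R]_n) (rho : R)
    (n_gt0 : (0 < n)%N)
    (theta_gt0 : forall i : 'I_n, 0 < theta i 0)
    (rho_lb : (1 < n)%N -> - (1 / (n%:R - 1)) < rho)
    (rho_lt1 : rho < 1) :
  (exists! t : R, is_fixed_threshold rho theta t) /\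
  (forall t : R, is_fixed_threshold rho theta t ->
     forall y : 'cV[R]_n,
       is_minimizer (qp_objective (const_corr n rho) theta)
         (@nonneg_vec R n) y <->
       y = (1 / (1 - rho)) *: pos_part (theta - t *: ones R n)) /\
  ((forall i j : 'I_n, (i <= j)%N -> theta j 0 <= theta i 0) ->
     (exists k : 'I_n, is_largest_index (threshold_cond rho theta) k) /\
     (forall k : 'I_n, is_largest_index (threshold_cond rho theta) k ->
        forall t : R,
          is_fixed_threshold rho theta t <-> t = threshold_formula rho theta k)).
Proof.
have denom_gt0 m : (m <= n)%N -> 0 < 1 - rho + m%:R * rho.
  exact: corr_denom_gt0.
have set_denom_gt0 (A : {set 'I_n}) : 0 < 1 - rho + #|A|%:R * rho.
  by apply: denom_gt0; rewrite -[X in (_ <= X)%N]card_ord max_card.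
have fixedE w t : scaled_threshold rho (fun i => theta i 0) w ->
    is_fixed_threshold rho theta t <-> t = rho * w.
  move=> fix_w; rewrite fixed_threshold_scaled //; split=> [[w' fix_w' ->]|->].
    by rewrite (scaled_threshold_unique set_denom_gt0 fix_w' fix_w).
  by exists w.
split; [|split=> [t fix_t y|theta_sorted]].
- have [w fix_w] := scaled_threshold_exists (fun i => theta i 0) set_denom_gt0.
  exists (rho * w); split=> [|t]; first exact/(fixedE w).
  by move/(fixedE w t fix_w).
- by apply: corr_qp_minimizer => //; exact: denom_gt0.
- split=> [|k k_max t].
    apply: (@largest_index_exists _ (fun k : 'I_n => rho <= theta k 0 /
         (theta k 0 + \sum_(j < n | (j < k)%N) (theta j 0 - theta k 0)))).
    (* At the first index the sum is empty and the bound on [rho] is 1. *)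
    exists (Ordinal n_gt0); rewrite big_pred0 // addr0 divff ?ltW //.
    by rewrite gt_eqF.
  rewrite (fixedE _ t (largest_index_active theta_gt0 theta_sorted denom_gt0 k_max)).
  by rewrite /threshold_formula mulrCA mulrC mulrAC mulrC mulrA.
Qed.
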